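(* For every rotation $R_0\in SO(2)$ there exists $u\in W^{1,2}_{loc}(\mathbb{R}^2,\mathbb{R}^2)$ with $\mathrm{dist}(\nabla u,SO(2))\in L^2(\mathbb{R}^2)\setminus\{0\}$ such that $$\min_{R\in SO(2)}\|\nabla u-R\|_{L^2(\mathbb{R}^2)}=\|\nabla u-R_0\|_{L^2(\mathbb{R}^2)}=\sqrt2\,\|\mathrm{dist}(\nabla u,SO(2))\|_{L^2(\mathbb{R}^2)}.$$
   Context: $SO(2)$ is the group of proper rotations of $\mathbb{R}^2$, viewed in $\mathbb{R}^{2\times2}$. Matrices carry the Frobenius norm $|A|^2=\mathrm{tr}(A^TA)$, and $L^2$ norms of matrix fields as well as the distance $\mathrm{dist}(F,SO(2))=\min_{R\in SO(2)}|F-R|$ (applied pointwise to $\nabla u(x)$) use this norm. $\|\nabla u-R\|_{L^2(\mathbb{R}^2)}$ may equal $+\infty$ for some $R$. *)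

(* Defs.v *)
From mathcomp Require Export all_boot all_order all_algebra.
From mathcomp Require Export all_classical all_reals all_analysis.

Set Implicit Arguments.
Unset Strict Implicit.
Unset Printing Implicit Defensive.

Export Order.TTheory GRing.Theory Num.Theory.
Export numFieldNormedType.Exports.

Local Open Scope classical_set_scope.
Local Open Scope ring_scope.

Definition SO2 (R : realType) : set 'M[R]_2 :=
  [set Q | Q^T *m Q = 1%:M /\ \det Q = 1].
Arguments SO2 R : clear implicits.

Definition frob (R : realType) (A : 'M[R]_2) : R := Num.sqrt (\tr (A^T *m A)).

(* SO2 is compact and nonempty, so this infimum is a minimum. *)
Definition dist_SO2 (R : realType) (F : 'M[R]_2) : R :=
  inf [set frob (F - Q) | Q in SO2 R].

Definition leb2 (R : realType) :
    {measure set (measurableTypeR R * measurableTypeR R) -> \bar R} :=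
  ((@lebesgue_measure R) \x (@lebesgue_measure R))%E.
Arguments leb2 R : clear implicits.

(* With values in [0, +oo]. *)
Definition L2norm (R : realType) (f : R * R -> R) : \bar R :=
  'N[leb2 R]_2%:E[EFin \o f].

Definition L2norm_mx (R : realType) (G : R * R -> 'M[R]_2) : \bar R :=
  L2norm (fun x => frob (G x)).

Definition basis2 (R : realType) (j : 'I_2) : R * R :=
  if j == ord0 then (1, 0) else (0, 1).

(* On the plane, C^k is the same as having continuous partial derivatives
   up to order k. *)
Fixpoint Ck (R : realType) (k : nat) (f : R * R -> R) : Prop :=
  if k is k'.+1 then
    continuous f /\
    forall j : 'I_2, (forall x, derivable f x (basis2 R j)) /\
                     Ck k' ('D_(basis2 R j) f)
  else continuous f.

Definition test_function (R : realType) (phi : R * R -> R) : Prop :=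
  (forall k, Ck k phi) /\ compact (closure [set x | phi x != 0]).

Definition L2loc (R : realType) (f : R * R -> R) : Prop :=
  forall K : set (R * R), compact K -> f \_ K \in Lfun (leb2 R) 2%:E.

(* For f and g in L2loc both integrands are integrable, so Rintegral, which is
   0 by convention on some functions that are not integrable, is harmless. *)
Definition weak_partial (R : realType) (j : 'I_2) (f g : R * R -> R) : Prop :=
  forall phi, test_function phi ->
    \int[leb2 R]_x (f x * 'D_(basis2 R j) phi x) =
    - \int[leb2 R]_x (g x * phi x).

(* u belongs to W^{1,2}_loc(R^2, R^2) and G represents its weak gradient,
   with the convention (grad u)_{ij} = d_j u_i; G is unique up to null sets. *)
Definition W12loc_grad (R : realType)
    (u : R * R -> 'cV[R]_2) (G : R * R -> 'M[R]_2) : Prop :=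
  forall i : 'I_2, L2loc (fun x => u x i ord0) /\
    forall j : 'I_2, L2loc (fun x => G x i j) /\
      weak_partial j (fun x => u x i ord0) (fun x => G x i j).

Definition is_min (R : realType) (A : set (\bar R)) (m : \bar R) : Prop :=
  A m /\ lbound A m.

(* Main.v *)
Require Import Defs.
From mathcomp Require Import ring lra measurable_realfun.

(* Identify the plane with the complex line, so that the gradient of u has
   conformal part u_z and anticonformal part u_zbar. Pointwise,
     |grad u - 1|^2 = 2 |u_z - 1|^2 + 2 |u_zbar|^2,
     dist(grad u, SO2)^2 = 2 (|u_z| - 1)^2 + 2 |u_zbar|^2,
   and the Beurling transform is an L^2 isometry, so u_z - 1 and u_zbar have the
   same norm. Hence the constant sqrt 2 is attained as soon as |u_z| = 1 almost
   everywhere. Radial solutions are explicit: we take u_z = -1 in the unit disc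
   and u_z = 1 outside, which gives u(x) = (1 - 2 / max(1, |x|^2)) x, followed
   by R0. Then |grad u - R0| = sqrt 8 / max(1, |x|^2), the distance to SO2 is the
   same function cut off to |x| >= 1, and for any other rotation Q the integrand
   |grad u - Q|^2 is bounded below by a positive constant off the disc. *)

Set Implicit Arguments.
Unset Strict Implicit.
Unset Printing Implicit Defensive.

Local Open Scope classical_set_scope.
Local Open Scope ring_scope.

(** * Measurability and local integrability in the plane *)

Section plane_measurability.
Context {R : realType}.
Local Notation R2 := (measurableTypeR R * measurableTypeR R)%type.

(** Second countability links the product topology to the product sigma-algebra: an open set is the
    countable union of the rational boxes it contains. *)
Lemma open_measurable_plane (U : set (R * R)) :
  open U -> measurable (U : set R2).
Proof.
move=> oU.
pose box (q : rat * rat * (rat * rat)) : set (R * R) :=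
  `](ratr q.1.1), (ratr q.1.2)[%classic `*` `](ratr q.2.1), (ratr q.2.2)[%classic.
have -> : U = \bigcup_q (if `[< box q `<=` U >] then box q else set0).
  apply/seteqP; split => [[x y] Uxy|z [q _]]; last first.
    by case: ifPn => // /asboolP; exact.
  have /nbhs_ballP[e /= e0 eU] : nbhs (x, y) U by exact: open_nbhs_nbhs.
  have rat2 (z : R) : exists2 p : rat * rat, z \in `]ratr p.1, ratr p.2[ &
      (z - e < ratr p.1 /\ ratr p.2 < z + e).
    have /rat_in_itvoo[p] : z - e < z by rewrite ltrBlDr ltrDl.
    rewrite in_itv/= => /andP[p1 p2].
    have /rat_in_itvoo[q] : z < z + e by rewrite ltrDl.
    rewrite in_itv/= => /andP[q1 q2].
    by exists (p, q) => //; rewrite in_itv/= p2 q1.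
  have [p xp [p1 p2]] := rat2 x.
  have [q yq [q1 q2]] := rat2 y.
  exists (p, q) => //; rewrite ifT//; apply/asboolP => -[a b] [/= ap bq].
  apply: eU; split => /=; rewrite /ball/= ltr_norml.
    by move: ap; rewrite in_itv/= => /andP[? ?]; lra.
  by move: bq; rewrite in_itv/= => /andP[? ?]; lra.
apply: countable_bigcupT_measurable => // q; case: ifPn => // _.
by apply: measurableX; exact: measurable_itv.
Qed.

Lemma continuous_measurable_plane (f : R * R -> R) :
  continuous f -> measurable_fun [set: R2] f.
Proof.
move=> /continuousP cf; apply: (measurability _ (RGenOpens.measurableE R)).
move=> _ [_ [a [b ->] <-]]; rewrite setTI.
by apply: open_measurable_plane; exact/cf/interval_open.
Qed.

Definition square (M : R) : set (R * R) := `[- M, M]%classic `*` `[- M, M]%classic.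

Lemma squareP (M : R) x : square M x <-> `|x.1| <= M /\ `|x.2| <= M.
Proof. by rewrite /square /= !in_itv/= !ler_norml. Qed.

Lemma measurable_square M : measurable (square M : set R2).
Proof. by apply: measurableX; exact: measurable_itv. Qed.

Lemma compact_measurable_plane (K : set (R * R)) :
  compact K -> measurable (K : set R2).
Proof.
move=> cK; rewrite -(setCK K); apply: measurableC; apply: open_measurable_plane.
by apply: closed_openC; apply: compact_closed => //; exact: norm_hausdorff.
Qed.

Lemma compact_sub_square (K : set (R * R)) : compact K ->
  exists2 M, 0 < M & K `<=` square M.
Proof.
move=> /compact_bounded[M0 [_ M0K]].
exists (Num.max 1 (M0 + 1)); first by rewrite lt_max ltr01.
move=> x Kx; apply/squareP.
have : `|x| <= Num.max 1 (M0 + 1).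
  by apply: (M0K (Num.max 1 (M0 + 1))) => //; rewrite lt_max ltrDl ltr01 orbT.
by rewrite prod_normE /= ge_max => /andP[].
Qed.

Lemma leb2_square_lty (M : R) : (leb2 R (square M) < +oo)%E.
Proof.
rewrite [leb2 R _]product_measure1E; [|exact: measurable_itv..].
rewrite /= lebesgue_measure_itv/=.
by case: ifPn => _; rewrite ?mule0 ?ltry// -EFinB -EFinM ltry.
Qed.

(** Measurability is bundled in, so the class is closed under sums and products and gives both
    [L2loc] and integrability against test functions. *)
Definition locally_bounded (f : R * R -> R) :=
  measurable_fun [set: R2] f /\
  forall M, exists C, forall x, square M x -> `|f x| <= C.

Lemma continuous_locally_bounded (f : R * R -> R) :
  continuous f -> locally_bounded f.
Proof.
move=> cf; split; first exact: continuous_measurable_plane.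
move=> M; have : compact (f @` square M).
  apply: continuous_compact; first by move=> x; apply: continuous_subspaceT.
  by apply: compact_setX; exact: segment_compact.
move=> /compact_bounded[C0 [_ C0K]]; exists (C0 + 1) => x Mx.
by apply: C0K; [rewrite ltrDl|exists x].
Qed.

Lemma locally_boundedD f g :
  locally_bounded f -> locally_bounded g -> locally_bounded (fun x => f x + g x).
Proof.
move=> [mf bf] [mg bg]; split; first exact: measurable_funD.
move=> M; have [C fC] := bf M; have [D gD] := bg M.
exists (C + D) => x Mx; rewrite (le_trans (ler_normD _ _))// lerD//.
  exact: fC.
exact: gD.
Qed.

Lemma locally_boundedM f g :
  locally_bounded f -> locally_bounded g -> locally_bounded (fun x => f x * g x).
Proof.
move=> [mf bf] [mg bg]; split; first exact: measurable_funM.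
move=> M; have [C fC] := bf M; have [D gD] := bg M.
by exists (C * D) => x Mx; rewrite normrM ler_pM// ?fC ?gD.
Qed.

Lemma locally_bounded_integrable f M : locally_bounded f ->
  (forall x, ~ square M x -> f x = 0) ->
  (leb2 R).-integrable setT (EFin \o f).
Proof.
move=> [mf bf] f0; have [C fC] := bf M.
have -> : f = f \_ (square M).
  by apply/funext => x; rewrite patchE; case: ifPn => // /negP; rewrite inE => /f0.
rewrite -restrict_EFin; apply/integrable_restrict => //=; first exact: measurable_square.
rewrite setTI; apply: measurable_bounded_integrable => //=.
- exact: measurable_square.
- exact: leb2_square_lty.
- exact: measurable_funTS.
- exists C; split; first exact: num_real.
  by move=> y Cy x Mx; apply: le_trans (ltW Cy); exact: fC.
Qed.

Lemma locally_bounded_L2loc f : locally_bounded f -> L2loc f.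
Proof.
move=> [mf bf] K cK; have [M M0 KM] := compact_sub_square cK.
have mK := compact_measurable_plane cK.
have mfK : measurable_fun [set: R2] (f \_ K).
  by apply/(measurable_restrict _ _ _).1 => //; exact: measurable_funTS.
apply/andP; rewrite !inE /=; split; first exact: mfK.
have [C fC] := bf M.
pose g := fun x => `|(f \_ K) x| `^ 2.
have ig : (leb2 R).-integrable setT (EFin \o g).
  apply: (@locally_bounded_integrable _ M); last first.
    move=> x Mx; rewrite /g patchE memNset ?normr0 ?powR0//.
    by apply: contra_not Mx; exact: KM.
  split.
    apply: (measurableT_comp (measurable_powR _)); exact: measurableT_comp.
  (* [C] bounds [f] only on [square M], but [g] vanishes off [K], so the same bound serves every
     [M']. *)
  move=> M'; exists (`|C| ^+ 2) => x _; rewrite /g ger0_norm ?powR_ge0// powR_mulrn//.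
  rewrite lerXn2r ?nnegrE// patchE; case: ifPn => [|_]; last by rewrite normr0.
  by rewrite inE => Kx; rewrite (le_trans (fC x _) (ler_norm C))//; exact: KM.
rewrite /finite_norm unlock poweR_lty//.
move/integrableP : ig => [_]; apply: le_lt_trans.
rewrite le_eqVlt; apply/orP; left; apply/eqP/eq_integral => x _ /=.
by rewrite (ger0_norm (powR_ge0 _ _)).
Qed.
End plane_measurability.

(** * The profile 1 - 2 / max(1, s) and its weak derivative *)

(** The argument stands for the squared radius, which keeps square roots out of the derivatives.
    Both branches equal -1 at [s = 1], so the profile is continuous there. *)
Definition prof (R : realType) (s : R) : R := 1 - 2 / Num.max 1 s.
(* The derivative of prof, with its right-hand value at the kink s = 1. *)
Definition dprof (R : realType) (s : R) : R := (1 <= s)%R%:R * (2 / Num.max 1 s ^+ 2).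

Section profile.
Context {R : realType}.
Implicit Types s t a b c : R.
Local Notation mu := (@lebesgue_measure R).

Lemma prof_le1 s : s <= 1 -> prof s = -1.
Proof. by move=> s1; rewrite /prof max_l// divr1; lra. Qed.

Lemma prof_ge1 s : 1 <= s -> prof s = 1 - 2 / s.
Proof. by move=> s1; rewrite /prof max_r. Qed.

Lemma dprof_lt1 s : s < 1 -> dprof s = 0.
Proof. by move=> s1; rewrite /dprof leNgt s1 mul0r. Qed.

Lemma dprof_ge1 s : 1 <= s -> dprof s = 2 / s ^+ 2.
Proof. by move=> s1; rewrite /dprof s1 mul1r max_r. Qed.

Lemma measurable_invmax : measurable_fun [set: R] (fun s => (Num.max 1 s)^-1).
Proof.
apply: continuous_measurable_fun => s; apply: cvgV.
  by rewrite gt_eqF// lt_max ltr01.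
by apply: continuous_max; [exact: cvg_cst|exact: cvg_id].
Qed.

Lemma measurable_prof : measurable_fun [set: R] (@prof R).
Proof.
by apply: measurable_funB => //; apply: measurable_funM => //; exact: measurable_invmax.
Qed.

Lemma measurable_ge1 : measurable_fun [set: R] (fun s : R => (1 <= s)%R%:R : R).
Proof.
rewrite (_ : (fun _ => _) = \1_`[1, +oo[%classic); first exact: measurable_indic.
by apply/funext => s; rewrite indicE mem_setE/= in_itv/= andbT.
Qed.

Lemma measurable_dprof : measurable_fun [set: R] (@dprof R).
Proof.
apply: measurable_funM; first exact: measurable_ge1.
apply: measurable_funM => //.
under eq_fun do rewrite -exprVn.
by apply: measurable_funX; exact: measurable_invmax.
Qed.

Lemma is_deriveM_fun (f g : R -> R) t (df dg : R) :
  is_derive t (1:R) f df -> is_derive t (1:R) g dg ->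
  is_derive t (1:R) (fun u => f u * g u) (f t * dg + df * g t).
Proof. by move=> dft dgt; rewrite [df * _]mulrC; exact: is_deriveM. Qed.

Lemma is_derive_affine a b t : is_derive t (1:R) (fun u => a * u + b) a.
Proof.
rewrite -[X in is_derive _ _ _ X]addr0; apply: is_deriveD.
rewrite [X in is_derive _ _ _ X](_ : _ = a * 1 + 0 * t); last by ring.
exact: is_deriveM_fun.
Qed.

(** The endpoints are null, so [h] need only agree with [dF] inside; this tolerates a kink at either
    end. Half-open intervals concatenate without overlap. *)
Lemma integral_derive_oc (F dF h : R -> R) x y : x <= y ->
  (forall t, x <= t <= y -> is_derive t 1 F (dF t)) ->
  (forall t, x <= t <= y -> {for t, continuous dF}) ->
  measurable_fun [set: R] h ->
  (forall t, x < t < y -> h t = dF t) ->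
  (\int[mu]_(t in `]x, y]) (h t)%:E = (F y - F x)%:E)%E.
Proof.
rewrite le_eqVlt => /predU1P[-> _ _ _ _|xy FdF cdF mh hdF].
  by rewrite set_itv_ge ?integral_set0 ?subrr// bnd_simp ltxx.
rewrite integral_itv_bndoo; last by apply/measurable_EFinP; exact: measurable_funTS.
transitivity (\int[mu]_(t in `]x, y[) (dF t)%:E)%E.
  by apply: eq_integral => t; rewrite inE/= in_itv => /hdF ->.
have cdFw : {within `[x, y], continuous dF}.
  by apply: continuous_in_subspaceT => t; rewrite inE/= in_itv; exact: cdF.
have cF t : x <= t <= y -> {for t, continuous F}.
  move=> /FdF [dFt _]; exact/differentiable_continuous/derivable1_diffP.
(* The integrand is now the continuous [dF], so the endpoints can be put back and the fundamental
   theorem applied on the closed interval. *)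
rewrite -(@integral_itv_bndoo _ _ _ _ true false); last first.
  apply/measurable_EFinP; apply: open_continuous_measurable_fun.
    exact: interval_open.
  by move=> t; rewrite inE/= in_itv => /andP[? ?]; apply: cdF; rewrite !ltW.
rewrite (continuous_FTC2 xy cdFw (F := F)) ?EFinB//.
- split.
  + by move=> t; rewrite in_itv => /andP[? ?]; apply: ex_derive; apply: FdF; rewrite !ltW.
  + by apply: cvg_at_right_filter; apply: cF; rewrite lexx ltW.
  + by apply: cvg_at_left_filter; apply: cF; rewrite lexx ltW.
- move=> t; rewrite in_itv => /andP[? ?]; rewrite derive1E; apply: derive_val.
  by apply: FdF; rewrite !ltW.
Qed.

(** * Integration by parts along a single line *)

Section slice.
Variables (a b c : R) (f df : R -> R).
Hypothesis fdf : forall t, is_derive t (1:R) f (df t).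
Hypothesis cdf : continuous df.

(** The data model a line at offset [c], with [f] a restricted test function and [a * t + b] a
    restricted linear form. Away from the kinks [t ^+ 2 + c ^+ 2 = 1], [h] is the derivative of [F],
    grouped as in the weak derivative identity. *)
Let h t := (a * t + b) * prof (t ^+ 2 + c ^+ 2) * df t +
  (a * prof (t ^+ 2 + c ^+ 2) +
   (a * t + b) * (dprof (t ^+ 2 + c ^+ 2) * (2 * t))) * f t.
Let F t := (a * t + b) * prof (t ^+ 2 + c ^+ 2) * f t.

Let cf : continuous f.
Proof.
move=> t; have [dft _] := fdf t.
exact/differentiable_continuous/derivable1_diffP.
Qed.

Let mh : measurable_fun [set: R] h.
Proof.
have ms : measurable_fun [set: R] (fun t => t ^+ 2 + c ^+ 2).
  by apply: measurable_funD => //; exact: measurable_funX.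
have ml : measurable_fun [set: R] (fun t => a * t + b).
  by apply: measurable_funD => //; exact: measurable_funM.
have mf := continuous_measurable_fun cf.
have mdf := continuous_measurable_fun cdf.
have mp := measurableT_comp measurable_prof ms.
have mdp := measurableT_comp measurable_dprof ms.
apply: measurable_funD; apply: measurable_funM => //.
  exact: measurable_funM.
apply: measurable_funD; first exact: measurable_funM.
by do 3! apply: measurable_funM => //.
Qed.

Let cl : continuous (fun t => a * t + b).
Proof.
by move=> t; apply: cvgD; [apply: cvgM; [exact: cvg_cst|exact: cvg_id]|exact: cvg_cst].
Qed.

(** Here [prof] is -1, so [F] coincides with a smooth function. The strict bound is asked only
    inside because at the kink [dprof] takes its right-hand value. *)
Let piece_in x y : x <= y -> (forall t, x <= t <= y -> t ^+ 2 + c ^+ 2 <= 1) ->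
  (forall t, x < t < y -> t ^+ 2 + c ^+ 2 < 1) ->
  (\int[mu]_(t in `]x, y]) (h t)%:E = (F y - F x)%:E)%E.
Proof.
move=> xy le1 lt1.
pose G t := - (a * t + b) * f t.
transitivity (G y - G x)%:E; last first.
  by rewrite /G /F !prof_le1 ?le1 ?lexx ?xy//; congr EFin; ring.
pose dG t := - (a * t + b) * df t - a * f t.
apply: (@integral_derive_oc G dG h x y xy _ _ mh).
- move=> t _; rewrite (_ : dG t = (- (a * t + b)) * df t + - a * f t); last first.
    by rewrite /dG; ring.
  apply: is_deriveM_fun; apply: is_deriveN; exact: is_derive_affine.
- move=> t _; apply: cvgB; apply: cvgM; [|exact: cdf|exact: cvg_cst|exact: cf].
  by apply: cvgN; exact: cl.
- by move=> t /lt1 t1; rewrite /h /dG prof_le1 ?(ltW t1)// dprof_lt1//; ring.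
Qed.

(** The formula [1 - 2 / q] replaces [prof]: it is smooth wherever [q] is nonzero, hence
    differentiable from both sides even at an endpoint on the unit circle. *)
Let piece_out x y : x <= y -> (forall t, x <= t <= y -> 1 <= t ^+ 2 + c ^+ 2) ->
  (\int[mu]_(t in `]x, y]) (h t)%:E = (F y - F x)%:E)%E.
Proof.
move=> xy ge1.
pose q t := (t ^+ 2 + c ^+ 2).
have cq : continuous q.
  by move=> t; apply: cvgD; [exact: exprn_continuous|exact: cvg_cst].
have q0 t : x <= t <= y -> q t != 0.
  by move=> /ge1 ?; rewrite gt_eqF//; exact: lt_le_trans.
pose G t := (a * t + b) * (1 - 2 * (q t)^-1) * f t.
transitivity (G y - G x)%:E; last first.
  by rewrite /G /F !prof_ge1 ?ge1 ?lexx ?xy.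
pose dG t := (a * t + b) * (1 - 2 * (q t)^-1) * df t +
   (a * (1 - 2 * (q t)^-1) + (a * t + b) * (2 * (q t)^-1 ^+ 2 * (2 * t))) * f t.
apply: (@integral_derive_oc G dG h x y xy _ _ mh).
- move=> t /q0 qt.
  have dq : is_derive t (1 : R) q (2 * t).
    rewrite (_ : q = (fun u => u * u + c ^+ 2)); last first.
      by apply/funext => u; rewrite /q expr2.
    rewrite [X in is_derive _ _ _ X](_ : _ = (t * 1 + 1 * t) + 0); last by ring.
    apply: is_deriveD; exact: is_deriveM_fun.
  have dqV := is_deriveV qt dq.
  have dp : is_derive t (1:R) (fun u => 1 - 2 * (q u)^-1) (2 * (q t)^-1 ^+ 2 * (2 * t)).
    rewrite [X in is_derive _ _ _ X](_ : _ =
      0 - (2 * (- q t ^- 2 *: (2 * t)) + 0 * (q t)^-1)); last first.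
      by rewrite /GRing.scale/= exprVn; ring.
    by apply: is_deriveB; exact: is_deriveM_fun.
  rewrite (_ : dG t = (a * t + b) * (1 - 2 * (q t)^-1) * df t +
   ((a * t + b) * (2 * (q t)^-1 ^+ 2 * (2 * t)) +
     a * (1 - 2 * (q t)^-1)) * f t); last first.
    by rewrite /dG; ring.
  apply: is_deriveM_fun; apply: is_deriveM_fun; exact: is_derive_affine.
- move=> t /q0 qt.
  have cqV : {for t, continuous (fun t => (q t)^-1)} by apply: cvgV => //; exact: cq.
  have cp : {for t, continuous (fun t => 1 - 2 * (q t)^-1)}.
    by apply: cvgB; [exact: cvg_cst|apply: cvgM; [exact: cvg_cst|exact: cqV]].
  have c2 : {for t, continuous (fun t => 2 * (q t)^-1 ^+ 2 * (2 * t))}.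
    apply: cvgM; apply: cvgM; [exact: cvg_cst| |exact: cvg_cst|exact: cvg_id].
    by apply: cvgM; exact: cqV.
  apply: cvgD; apply: cvgM; [|exact: cdf| |exact: cf].
    by apply: cvgM; [exact: cl|exact: cp].
  by apply: cvgD; apply: cvgM; [exact: cvg_cst|exact: cp|exact: cl|exact: c2].
- move=> t /andP[xt ty]; have t1 : 1 <= t ^+ 2 + c ^+ 2 by apply: ge1; rewrite !ltW.
  by rewrite /h (prof_ge1 t1) (dprof_ge1 t1) /dG /q !exprVn.
Qed.

Let split_oc x y z : x <= y -> y <= z ->
  (\int[mu]_(t in `]x, z]) (h t)%:E =
   \int[mu]_(t in `]x, y]) (h t)%:E + \int[mu]_(t in `]y, z]) (h t)%:E)%E.
Proof.
move=> xy yz; rewrite -integral_setU//=.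
- congr integral; rewrite -itv_bndbnd_setU// bnd_simp//.
- by apply/measurable_EFinP; exact: measurable_funTS.
- apply/disj_set2P/seteqP; split => // t; rewrite /= !in_itv/=.
  by move=> [/andP[_ ty] /andP[yt _]]; move: ty; rewrite leNgt yt.
Qed.

(** Cut where the line crosses the unit circle: since [F] is single-valued at the kinks, the
    boundary terms telescope to [F N - F (- N)], which vanishes by the support condition. *)
Lemma integral_slice (M : R) : (forall t, M <= `|t| -> f t = 0 /\ df t = 0) ->
  (\int[mu]_t ((a * t + b) * prof (t ^+ 2 + c ^+ 2) * df t +
    (a * prof (t ^+ 2 + c ^+ 2) +
     (a * t + b) * (dprof (t ^+ 2 + c ^+ 2) * (2 * t))) * f t)%:E = 0)%E.
Proof.
(* The kinks lie in [-1, 1], so [N >= 2] places them inside the interval of integration. *)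
move=> fM; pose N := Num.max M 2.
have N2 : 2 <= N by rewrite le_max lexx orbT.
have NM : M <= N by rewrite le_max lexx.
have FN t : N <= `|t| -> F t = 0.
  by move=> /(le_trans NM)/fM[f0 _]; rewrite /F f0 mulr0.
transitivity (\int[mu]_(t in `](- N)%R, N]) (h t)%:E)%E.
  rewrite [RHS]integral_mkcond; apply: eq_integral => t _; rewrite patchE.
  case: ifPn => // /negP; rewrite inE/= in_itv/= => /negP tN.
  have /fM[f0 df0] : M <= `|t|.
    apply: le_trans NM _; rewrite leNgt ltr_norml; apply: contra tN.
    by move=> /andP[-> /ltW].
  by rewrite f0 df0 !mulr0 addr0.
suff -> : (\int[mu]_(t in `](- N)%R, N]) (h t)%:E = (F N - F (- N))%R%:E)%E.
  by rewrite !FN ?normrN ?ger0_norm ?subrr//; lra.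
(* A line with [1 <= c ^+ 2] misses the open disc and forms a single outer piece; otherwise it meets
   the circle at [- r] and [r]. *)
have [c1|c1] := leP 1 (c ^+ 2).
  apply: piece_out => [|t _]; first by lra.
  by rewrite (le_trans c1)// lerDr sqr_ge0.
pose r := Num.sqrt (1 - c ^+ 2).
have r2 : r ^+ 2 = 1 - c ^+ 2 by rewrite sqr_sqrtr// subr_ge0 ltW.
have r0 : 0 < r by rewrite sqrtr_gt0 subr_gt0.
have c0 : 0 <= c ^+ 2 by exact: sqr_ge0.
have r1 : r <= 1 by nra.
rewrite (@split_oc _ (- r)); [|lra..].
rewrite (@split_oc _ r N); [|lra..].
rewrite piece_out; [|lra|]; last by move=> t /andP[t1 t2]; nra.
rewrite piece_in; [|lra| |]; [|by move=> t /andP[t1 t2]; nra..].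
rewrite piece_out; [|lra|]; last by move=> t /andP[t1 t2]; nra.
by rewrite -!EFinD; congr EFin; ring.
Qed.

End slice.
End profile.

(** * Weak partial derivatives of linear forms times the radial profile *)

Definition sqnorm (R : realType) (x : R * R) : R := x.1 ^+ 2 + x.2 ^+ 2.

Definition coord (R : realType) (j : 'I_2) (x : R * R) : R :=
  if j == ord0 then x.1 else x.2.

Section radial_weak_gradient.
Context {R : realType}.
Implicit Types (x : R * R) (j : 'I_2).
Local Notation R2 := (measurableTypeR R * measurableTypeR R)%type.
Local Notation mu := (@lebesgue_measure R).

Lemma measurable_sqnorm : measurable_fun [set: R2] (@sqnorm R).
Proof. by apply: measurable_funD; apply: measurable_funX. Qed.

Lemma bounded_locally_bounded (f : R * R -> R) C :
  measurable_fun [set: R2] f -> (forall x, `|f x| <= C) -> locally_bounded f.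
Proof. by move=> mf fC; split => // M; exists C. Qed.

Lemma coord_locally_bounded j : locally_bounded (@coord R j).
Proof.
rewrite /coord; case: (j == ord0).
  by split; [exact: measurable_fst|move=> M; exists M => x /squareP[]].
by split; [exact: measurable_snd|move=> M; exists M => x /squareP[]].
Qed.

Lemma invmax_itv (s : R) : 0 < (Num.max 1 s)^-1 <= 1.
Proof.
have m1 : 1 <= Num.max 1 s by rewrite le_max lexx.
by rewrite invr_gt0 (lt_le_trans ltr01 m1) invf_le1// (lt_le_trans ltr01 m1).
Qed.

Lemma prof_locally_bounded : locally_bounded (fun x => prof (sqnorm x)).
Proof.
apply: (@bounded_locally_bounded _ 1).
  exact: measurableT_comp measurable_prof measurable_sqnorm.
move=> x; rewrite /prof; have /andP[] := invmax_itv (sqnorm x).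
by rewrite ler_norml; lra.
Qed.

Lemma dprof_locally_bounded : locally_bounded (fun x => dprof (sqnorm x)).
Proof.
apply: (@bounded_locally_bounded _ 2).
  exact: measurableT_comp measurable_dprof measurable_sqnorm.
move=> x; rewrite /dprof -exprVn; have /andP[i0 i1] := invmax_itv (sqnorm x).
have i2 : (Num.max 1 (sqnorm x))^-1 ^+ 2 <= 1 by rewrite exprn_ile1// ltW.
have i3 : 0 <= (Num.max 1 (sqnorm x))^-1 ^+ 2 by exact: sqr_ge0.
rewrite ger0_norm ?mulr_ge0//; case: (1 <= sqnorm x) => /=; lra.
Qed.

Lemma cst_locally_bounded (r : R) : locally_bounded (fun _ => r).
Proof. by apply: continuous_locally_bounded; exact: cst_continuous. Qed.

Lemma sum_coord_locally_bounded (a : 'I_2 -> R) :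
  locally_bounded (fun x => \sum_l a l * coord l x).
Proof.
under eq_fun do rewrite big_ord_recl big_ord1.
by apply: locally_boundedD;
  exact: (locally_boundedM (cst_locally_bounded _) (coord_locally_bounded _)).
Qed.

Lemma sum_coord_prof_locally_bounded (a : 'I_2 -> R) :
  locally_bounded (fun x => (\sum_l a l * coord l x) * prof (sqnorm x)).
Proof. exact: (locally_boundedM (sum_coord_locally_bounded a) prof_locally_bounded). Qed.

Lemma sum_coord_prof_gradient_locally_bounded (a : 'I_2 -> R) j :
  locally_bounded (fun x => a j * prof (sqnorm x) +
     (\sum_l a l * coord l x) * (dprof (sqnorm x) * (2 * coord j x))).
Proof.
have bp := prof_locally_bounded.
apply: (locally_boundedD (locally_boundedM (cst_locally_bounded (a j)) bp)).
apply: (locally_boundedM (sum_coord_locally_bounded a)).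
apply: (locally_boundedM dprof_locally_bounded).
exact: (locally_boundedM (cst_locally_bounded _) (coord_locally_bounded j)).
Qed.

Section test.
Variables (j : 'I_2) (phi : R * R -> R).
Hypothesis tphi : test_function phi.
Local Notation dphi := ('D_(basis2 R j) phi).

Lemma test_function_C1 :
  [/\ continuous phi, forall x, derivable phi x (basis2 R j) & continuous dphi].
Proof. by have [/(_ 1)/= [cphi /(_ j)[]]] := tphi. Qed.

Lemma test_function_support : exists2 M, 0 < M &
  forall x, ~ square M x -> phi x = 0 /\ dphi x = 0.
Proof.
have [_ cK] := tphi; have [M M0 KM] := compact_sub_square cK.
exists M => // x /(contra_not (@KM x)) Kx.
(* The complement of the closed support is open, so [phi] vanishes near [x] and its derivative at
   [x] vanishes too. *)
have nphi : \forall y \near x, phi y = 0.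
  have : nbhs x (~` closure [set y | phi y != 0]).
    apply: open_nbhs_nbhs; split => //.
    by apply: closed_openC; exact: closed_closure.
  apply: filterS => y; apply: contra_notP => /eqP y0; exact: subset_closure.
split; first exact: nbhs_singleton nphi.
by rewrite (near_eq_derive _ (g := cst 0))// derive_cst.
Qed.

(** The parameter [t] moves along [basis2 R j] and [c] labels the parallel lines, so one argument
    covers both directions. *)
Definition line (t c : R) : R * R := if j == ord0 then (t, c) else (c, t).

Lemma is_derive_line c t :
  is_derive t (1:R) (fun t => phi (line t c)) (dphi (line t c)).
Proof.
have [_ /(_ (line t c)) dphi _] := test_function_C1.
have E : (fun h => h^-1 *: (phi (h *: basis2 R j + line t c) - phi (line t c))) =
    (fun h => h^-1 *: (((fun t => phi (line t c)) \o shift t) (h *: (1:R)) -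
                       phi (line t c))).
  apply/funext => h /=; congr (_ *: (phi _ - _)); rewrite /line /basis2.
  by case: (j == ord0); congr pair; rewrite /= /GRing.scale/= ?mulr1 ?mulr0 ?add0r.
by apply: DeriveDef; rewrite /derivable /derive -E.
Qed.

Lemma continuous_line c : continuous (line ^~ c).
Proof.
move=> t; rewrite /line; case: (j == ord0).
  exact: (cvg_pair (F := nbhs t) (f := id) (g := cst c) cvg_id (cvg_cst c)).
exact: (cvg_pair (F := nbhs t) (f := cst c) (g := id) (cvg_cst c) cvg_id).
Qed.

Lemma coord_line t c : coord j (line t c) = t.
Proof. by rewrite /coord /line; case: (j == ord0). Qed.

Lemma sqnorm_line t c : sqnorm (line t c) = t ^+ 2 + c ^+ 2.
Proof. by rewrite /sqnorm /line; case: (j == ord0) => //=; rewrite addrC. Qed.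

Lemma sum_coord_line (a : 'I_2 -> R) t c :
  \sum_l a l * coord l (line t c) =
  a j * t + a (if j == ord0 then ord_max else ord0) * c.
Proof.
rewrite big_ord_recl big_ord1 /coord /line.
have -> : lift ord0 ord0 = ord_max :> 'I_2 by exact/val_inj.
case: (j =P ord0) => [->//|j0]; have -> : j = ord_max.
  by apply/val_inj; case: j j0 => -[|[|//]] i //= /eqP.
by rewrite /= addrC.
Qed.

(** Fubini, with the order of integration chosen so that the inner integral runs in direction
    [j]. *)
Lemma integral_lines (h : R * R -> R) : (leb2 R).-integrable setT (EFin \o h) ->
  (\int[leb2 R]_x (h x)%:E = \int[mu]_c \int[mu]_t (h (line t c))%:E)%E.
Proof.
move=> ih; rewrite /line; case: (j == ord0).
  by rewrite -(integral21_prod_meas1 ih).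
by rewrite -(integral12_prod_meas1 ih).
Qed.

End test.

(** By Fubini the identity reduces to lines in direction [j], and [integral_slice] gives 0 on each
    of them. *)
Lemma weak_partial_prof (a : 'I_2 -> R) j :
  weak_partial j (fun x => (\sum_l a l * coord l x) * prof (sqnorm x))
   (fun x => a j * prof (sqnorm x) +
     (\sum_l a l * coord l x) * (dprof (sqnorm x) * (2 * coord j x))).
Proof.
move=> phi tphi; pose f x := (\sum_l a l * coord l x) * prof (sqnorm x).
have [cphi dphi cdphi] := test_function_C1 j tphi.
have [M M0 phiM] := test_function_support j tphi.
have bphi := continuous_locally_bounded cphi.
have bdphi := continuous_locally_bounded cdphi.
pose g x := a j * prof (sqnorm x) +
  (\sum_l a l * coord l x) * (dprof (sqnorm x) * (2 * coord j x)).
have bf : locally_bounded f := sum_coord_prof_locally_bounded a.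
have bg : locally_bounded g := sum_coord_prof_gradient_locally_bounded a j.
have ifdphi : (leb2 R).-integrable setT (EFin \o (fun x => f x * 'D_(basis2 R j) phi x)).
  apply: (@locally_bounded_integrable _ _ M); first exact: locally_boundedM.
  by move=> x /phiM[_ ->]; rewrite mulr0.
have igphi : (leb2 R).-integrable setT (EFin \o (fun x => g x * phi x)).
  apply: (@locally_bounded_integrable _ _ M); first exact: locally_boundedM.
  by move=> x /phiM[-> _]; rewrite mulr0.
(* Both integrands are integrable, so the two sides merge into one integral to be shown zero. *)
rewrite -/f -/g; apply/eqP; rewrite -addr_eq0 -RintegralD//; apply/eqP.
have ih : (leb2 R).-integrable setT
    (EFin \o (fun x => f x * 'D_(basis2 R j) phi x + g x * phi x)).
  by have := integrableD measurableT ifdphi igphi.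
rewrite /Rintegral (integral_lines j ih) (_ : (\int[mu]_c _)%E = 0%E)//.
apply: integral0_eq => c _.
under eq_integral.
  move=> t _; rewrite /f /g sqnorm_line coord_line sum_coord_line.
  over.
(* The square is closed, so [M <= |t|] would not leave it; [M + 1] does. *)
apply: (@integral_slice _ _ _ _ (fun t => phi (line j t c))
  (fun t => 'D_(basis2 R j) phi (line j t c)) _ _ (M + 1)).
- by move=> t; exact: is_derive_line.
- move=> t; apply: (@continuous_comp _ _ _ (fun t => line j t c) ('D_(basis2 R j) phi)).
    exact: continuous_line.
  exact: cdphi.
- move=> t Mt; apply: phiM => /squareP; rewrite /line; case: (j == ord0) => /= -[]; lra.
Qed.

End radial_weak_gradient.

(** * Integration of radial functions *)

Section disc_area.
Context {R : realType}.
Local Notation R1 := (measurableTypeR R).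
Local Notation R2 := (measurableTypeR R * measurableTypeR R)%type.
Local Notation mu := (@lebesgue_measure R).

(** The rescaled pushforward agrees with Lebesgue measure on half-open intervals, and uniqueness
    does the rest. The planar version argues likewise on rectangles. *)
Lemma lebesgue_measure_dilation (r : R) (A : set R) : 0 < r -> measurable A ->
  (mu A = r%:E * mu (( *%R r) @^-1` A))%E.
Proof.
move=> r0 mA.
have mr : measurable_fun [set: R1] ( *%R r : R1 -> R1) by exact: measurable_funM.
have nr : 0 <= r := ltW r0.
apply: (@lebesgue_measure_unique _
  (mscale (NngNum nr) (pushforward mu ( *%R r : R1 -> R1)))) => //.
move=> _ [[a b]] _ <-.
rewrite [RHS](_ : _ = r%:E * mu (( *%R r) @^-1` `]a, b]%classic))%E//.
rewrite (_ : _ @^-1` _ = `](a / r), (b / r)]%classic); last first.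
  apply/seteqP; split => x; rewrite /= !in_itv/= ltr_pdivrMr// ler_pdivlMr//;
    by rewrite [r * x]mulrC.
rewrite !lebesgue_measure_itv/= !lte_fin ltr_pM2r ?invr_gt0//.
case: ifPn; rewrite ?mule0// => _.
by rewrite -EFinB -EFinM; congr EFin; field; rewrite gt_eqF.
Qed.

Lemma leb2_dilation (r : R) (A : set (R * R)) : 0 < r -> measurable (A : set R2) ->
  (leb2 R A = (r ^+ 2)%:E * leb2 R ((fun x => ((r * x.1)%R, (r * x.2)%R)) @^-1` A))%E.
Proof.
move=> r0 mA.
have mr : measurable_fun [set: R1] ( *%R r : R1 -> R1) by exact: measurable_funM.
have m2 : measurable_fun [set: R2] (fun x : R2 => ((r * x.1)%R, (r * x.2)%R) : R2).
  by apply: measurable_fun_pair; apply: measurable_funM.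
have nr : 0 <= r ^+ 2 := sqr_ge0 r.
apply: (@product_measure_unique _ _ _ _ _ mu mu
  (mscale (NngNum nr) (pushforward (leb2 R)
    (fun x : R2 => ((r * x.1)%R, (r * x.2)%R) : R2)))) => //.
move=> B C mB mC; rewrite [LHS](_ : _ = (r ^+ 2)%:E *
  leb2 R ((fun x => ((r * x.1)%R, (r * x.2)%R)) @^-1` (B `*` C)))%E//.
have mpre D : measurable D -> measurable (( *%R r) @^-1` D : set R1).
  by move=> mD; rewrite -[X in measurable X]setTI; exact: mr.
rewrite (_ : _ @^-1` _ = (( *%R r) @^-1` B) `*` (( *%R r) @^-1` C)); last first.
  by apply/seteqP; split => x.
transitivity ((r ^+ 2)%:E * (mu (( *%R r) @^-1` B) * mu (( *%R r) @^-1` C)))%E.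
  by congr (_ * _)%E; apply: product_measure1E; exact: mpre.
transitivity (mu B * mu C)%E => //.
rewrite (lebesgue_measure_dilation r0 mB) (lebesgue_measure_dilation r0 mC).
rewrite expr2 EFinM -!muleA; congr (_ * _)%E; rewrite !muleA.
by congr (_ * _)%E; rewrite muleC.
Qed.

Definition disc (s : R) : set (R * R) := [set x | sqnorm x <= s].

Lemma measurable_disc s : measurable (disc s : set R2).
Proof.
rewrite (_ : disc s = (@sqnorm R) @^-1` `]-oo, s]%classic).
  by rewrite -[X in measurable X]setTI; exact: measurable_sqnorm.
by apply/seteqP; split => x /=; rewrite in_itv.
Qed.

(** Dilation by [Num.sqrt s] carries the unit disc to [disc s], so area is linear in [s]. The unit
    disc has finite area since a square contains it, and positive area since it contains one. *)
Lemma disc_area : exists2 d : R, 0 < d &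
  forall s : R, 0 <= s -> leb2 R (disc s) = (s * d)%:E.
Proof.
have d1oo : (leb2 R (disc 1) < +oo)%E.
  apply: le_lt_trans (leb2_square_lty 1); apply: le_measure; rewrite ?inE.
  - exact: measurable_disc.
  - exact: measurable_square.
  - move=> x; rewrite /disc /sqnorm /= => x1; apply/squareP.
    by rewrite !ler_norml; split; apply/andP; split; nra.
have d1fin : leb2 R (disc 1) \is a fin_num by rewrite ge0_fin_numE.
exists (fine (leb2 R (disc 1))).
  apply: fine_gt0; rewrite d1oo andbT.
  pose Q : set (R * R) := `]0%R, 2^-1%R]%classic `*` `]0%R, 2^-1%R]%classic.
  apply: (@lt_le_trans _ _ (leb2 R Q)); last first.
    apply: le_measure; rewrite ?inE.
    - by apply: measurableX; exact: measurable_itv.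
    - exact: measurable_disc.
    - move=> x; rewrite /Q /disc /sqnorm /= !in_itv/= => -[/andP[? ?] /andP[? ?]]; nra.
  rewrite [leb2 R Q]product_measure1E; [|exact: measurable_itv..].
  rewrite /= lebesgue_measure_itv/= lte_fin invr_gt0 ltr0n.
  by rewrite -EFinB -EFinM lte_fin subr0 mulr_gt0// invr_gt0.
(* Dilation needs a positive ratio; [disc 0] is a single point, treated apart. *)
move=> s; rewrite le_eqVlt => /predU1P[<-|s0].
  rewrite mul0r (_ : disc 0 = [set 0] `*` [set 0]); last first.
    apply/seteqP; split => -[x y]; rewrite /disc /sqnorm /=.
      by move=> xy; split; nra.
    by move=> [-> ->]; rewrite expr0n addr0.
  rewrite [leb2 R _]product_measure1E; [|exact: measurable_set1..].
  by rewrite /= lebesgue_measure_set1 mule0.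
have r0 : 0 < Num.sqrt s by rewrite sqrtr_gt0.
rewrite (leb2_dilation r0 (@measurable_disc s)) (sqr_sqrtr (ltW s0)).
rewrite EFinM fineK//; congr (_ * _)%E; congr (leb2 R _).
apply/seteqP; split => x;
  by rewrite /disc /sqnorm /= !exprMn (sqr_sqrtr (ltW s0)) -mulrDr ger_pMr//.
Qed.

End disc_area.

Section radial_integral.
Context {R : realType}.
Local Notation R1 := (measurableTypeR R).
Local Notation R2 := (measurableTypeR R * measurableTypeR R)%type.
Local Notation mu := (@lebesgue_measure R).

Section area.
Variable d : R.
Hypotheses (d0 : 0 < d) (discE : forall s : R, 0 <= s -> leb2 R (disc s) = (s * d)%:E).

Lemma leb2_annulus (a b : R) : 0 <= a -> a <= b ->
  leb2 R ((@sqnorm R) @^-1` `]a, b]) = ((b - a) * d)%:E.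
Proof.
move=> a0 ab.
rewrite (_ : _ @^-1` _ = disc b `\` disc a); last first.
  apply/seteqP; split => x; rewrite /disc /= in_itv/= ltNge.
    by move=> /andP[/negP].
  by move=> [-> /negP ->].
rewrite measureD; [|exact: measurable_disc..|]; last first.
  by rewrite [X in (X < _)%E](discE (le_trans a0 ab)) ltry.
rewrite setIidr; last by move=> x; rewrite /disc /= => /le_trans; apply.
transitivity ((b * d)%:E - (a * d)%:E)%E.
  by congr (_ - _)%E; apply: discE => //; exact: le_trans ab.
by rewrite -EFinB mulrBl.
Qed.

(** Uniqueness of Lebesgue measure is used on the whole line, whereas the pushforward by [sqnorm]
    lives on the half-line. It is therefore completed by Lebesgue measure on the nonpositive reals,
    and the sum is tested on half-open intervals. *)
Lemma lebesgue_measure_sqnorm (A : set R) : measurable A -> A `<=` `]0, +oo[ ->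
  mu A = (d^-1%:E * leb2 R ((@sqnorm R) @^-1` A))%E.
Proof.
move=> mA A0.
have dV : 0 <= d^-1 by rewrite invr_ge0 ltW.
have mpos : measurable (`]0, +oo[%classic : set R1) by exact: measurable_itv.
have mneg : measurable (`]-oo, 0]%classic : set R1) by exact: measurable_itv.
have E (B : set R) : measurable B -> mu B =
    (d^-1%:E * leb2 R ((@sqnorm R) @^-1` (B `&` `]0%R, +oo[%classic)) +
     mu (B `&` `]-oo, 0%R]%classic))%E.
  move=> mB; rewrite (@lebesgue_measure_unique _ (measure_add (mscale (NngNum dV)
    (mrestr (pushforward (leb2 R) (@sqnorm R : R2 -> R1)) mpos))
    (mrestr mu mneg)) _ _ mB).
    exact: measurable_sqnorm.
  by move=> ms; rewrite [LHS]measure_addE.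
  move=> ms _ [[a b]] _ <-; rewrite [RHS]measure_addE.
  rewrite [RHS](_ : _ = 
    (d^-1%:E * leb2 R ((@sqnorm R) @^-1` (`]a, b]%classic `&` `]0%R, +oo[%classic)) +
     mu (`]a, b]%classic `&` `]-oo, 0%R]%classic))%E)//.
  have [ab|ba] := ltP a b; last first.
    by rewrite set_itv_ge ?bnd_simp -?leNgt// !set0I preimage_set0 !measure0 mule0 adde0.
  have -> : `]a, b]%classic `&` `]0, +oo[%classic =
      `](Num.max a 0), (Num.max b 0)]%classic.
    apply/seteqP; split => x; rewrite /= !in_itv/= andbT le_max gt_max.
      by move=> [/andP[-> ->] ->].
    by move=> /andP[/andP[-> x0] /orP[->|]]; rewrite ?x0// leNgt x0.
  have -> : `]a, b]%classic `&` `]-oo, 0]%classic =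
      `](Num.min a 0), (Num.min b 0)]%classic.
    apply/seteqP; split => x; rewrite /= !in_itv/= le_min gt_min.
      by move=> [/andP[-> ->] ->].
    by move=> /andP[/orP[->|x0] /andP[-> x1]]//; move: x1; rewrite leNgt x0.
  rewrite leb2_annulus; last 2 first.
    by rewrite le_max lexx orbT.
    by rewrite ge_max !le_max (ltW ab) lexx !orbT.
  rewrite !lebesgue_measure_itv/= !lte_fin ab.
  rewrite -EFinM mulrCA mulVf ?gt_eqF// mulr1 -!EFinB.
  rewrite (_ : (if _ then _ else _) = (Num.min b 0 - Num.min a 0)%:E).
    by rewrite -EFinD; congr EFin; case: (leP a 0); case: (leP b 0); lra.
  case: ltP => // ba; congr EFin; move: ba; case: (leP a 0); case: (leP b 0); lra.
rewrite E// (_ : A `&` `]-oo, 0]%classic = set0) ?measure0 ?adde0.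
  by congr (_ * leb2 R (_ @^-1` _))%E; apply/setIidPl.
by apply/seteqP; split => // x [/A0]; rewrite /= !in_itv/= andbT leNgt => ->.
Qed.

End area.

(* Discs have area proportional to the squared radius, so sqnorm pushes leb2
   forward to d times the Lebesgue measure of the half-line. This replaces polar
   coordinates, and d (the area of the unit disc) is never computed. *)
Lemma radial_integral : exists2 d : R, 0 < d & forall h : R -> \bar R,
  measurable_fun [set: R] h -> (forall t, 0 <= h t)%E ->
  (\int[leb2 R]_x h (sqnorm x) = d%:E * \int[mu]_(t in `[0%R, +oo[) h t)%E.
Proof.
have [d d0 discE] := @disc_area R; exists d => // h mh h0.
have dV : 0 <= d^-1 by rewrite invr_ge0 ltW.
have mpos : measurable (`]0, +oo[%classic : set R1) by exact: measurable_itv.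
(* [lebesgue_measure_sqnorm] covers only positive values, so the null sets [t = 0] and [disc 0] are
   removed first. *)
rewrite -integral_itv_obnd_cbnd; last exact: measurable_funTS.
transitivity (\int[leb2 R]_(x in (@sqnorm R) @^-1` `]0%R, +oo[) h (sqnorm x))%E.
  rewrite (ge0_negligible_integral (@measurable_disc R 0))//.
  - congr integral; apply/seteqP; split => x; rewrite /disc /= in_itv/= andbT ltNge.
      by move=> [_ /negP].
    by move=> /negP.
  - by apply: (measurableT_comp mh); exact: measurable_sqnorm.
  - by rewrite [LHS](discE 0 (lexx 0)) mul0r.
rewrite (eq_measure_integral
  (mscale (NngNum dV) (pushforward (leb2 R) (@sqnorm R : R2 -> R1)))).
- exact: measurable_sqnorm.
- move=> ms; rewrite ge0_integral_mscale//; last exact: measurable_funTS.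
  rewrite muleA -EFinM divff ?gt_eqF// mul1e ge0_integral_pushforward//.
  exact: measurable_funTS.
- by move=> ms A mA A0; exact: lebesgue_measure_sqnorm.
Qed.

End radial_integral.

(** * The candidate gradient, pointwise *)

Section matrices.
Context {R : realType}.
Implicit Types (A P Q : 'M[R]_2).

Lemma sum_ord2 (f : 'I_2 -> R) : \sum_i f i = f ord0 + f ord_max.
Proof. by rewrite big_ord_recr big_ord1/=; congr (f _ + _); exact/val_inj. Qed.

Lemma frob_sqr A : frob A ^+ 2 =
  A ord0 ord0 ^+ 2 + A ord0 ord_max ^+ 2 + A ord_max ord0 ^+ 2 + A ord_max ord_max ^+ 2.
Proof.
have E : \tr (A^T *m A) =
    A ord0 ord0 ^+ 2 + A ord0 ord_max ^+ 2 + A ord_max ord0 ^+ 2 + A ord_max ord_max ^+ 2.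
  by rewrite /mxtrace sum_ord2 !mxE !sum_ord2 !mxE; ring.
by rewrite /frob sqr_sqrtr ?E// !addr_ge0 ?sqr_ge0.
Qed.

Lemma frob_ge0 A : 0 <= frob A. Proof. exact: sqrtr_ge0. Qed.

Lemma frob_SO2 Q A : SO2 R Q -> frob (Q *m A) = frob A.
Proof. by move=> [QQ _]; rewrite /frob trmx_mul mulmxA -[_ *m Q]mulmxA QQ mulmx1. Qed.

Lemma SO2_entries P : SO2 R P ->
  [/\ P ord_max ord_max = P ord0 ord0, P ord0 ord_max = - P ord_max ord0 &
      P ord0 ord0 ^+ 2 + P ord_max ord0 ^+ 2 = 1].
Proof.
move=> [PP]; rewrite (expand_det_row _ ord0) sum_ord2 /cofactor !det_mx11 !mxE/=.
rewrite (_ : lift ord0 (0 : 'I_1) = ord_max); last exact/val_inj.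
rewrite (_ : lift ord_max (0 : 'I_1) = ord0); last exact/val_inj.
rewrite expr0 expr1 => D.
have E i j : (P^T *m P) i j = (i == j)%:R by rewrite PP mxE.
have := E ord0 ord0; have := E ord_max ord_max.
rewrite !mxE !sum_ord2 !mxE/= => E11 E00.
set a := P ord0 ord0 in D E11 E00 *.
set b := P ord0 ord_max in D E11 E00 *.
set c := P ord_max ord0 in D E11 E00 *.
set e := P ord_max ord_max in D E11 E00 *.
(* The left side is the squared Frobenius norm minus twice the determinant, that is 2 - 2. *)
have S : (e - a) ^+ 2 + (b + c) ^+ 2 = 0.
  transitivity ((a * a + c * c) + (b * b + e * e) - 2 * (a * (1 * e) + b * (-1 * c))).
    by ring.
  by rewrite E00 E11 D; ring.
have : (e - a == 0) && (b + c == 0).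
  by rewrite -[e - a == 0]sqrf_eq0 -[b + c == 0]sqrf_eq0 -paddr_eq0 ?sqr_ge0// S.
move=> /andP[/eqP ea /eqP bc].
by split; [exact: subr0_eq|by apply/eqP; rewrite -addr_eq0 bc|rewrite !expr2].
Qed.

End matrices.

Section field.
Context {R : realType}.
Variables (R0 : 'M[R]_2) (hR0 : SO2 R R0).

(** The gradient of [prof (sqnorm x)] times [x], namely [prof] times the identity plus [2 * dprof]
    times the outer product of [x] with itself. *)
Definition stretch (x : R * R) : 'M[R]_2 :=
  \matrix_(i, j) ((i == j)%:R * prof (sqnorm x) +
    coord i x * (dprof (sqnorm x) * (2 * coord j x))).

(** Here [stretch x] is minus the identity, and [P] has trace [2 * P ord0 ord0]. *)
Lemma frob_stretch_in P x : SO2 R P -> sqnorm x < 1 ->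
  frob (stretch x - P) ^+ 2 = 4 * (1 + P ord0 ord0).
Proof.
move=> /SO2_entries[P11 P01 P00] x1.
rewrite frob_sqr !mxE/= (prof_le1 (ltW x1)) dprof_lt1// P11 P01; nra.
Qed.

(** Off the disc [stretch x] is the identity plus [2 / sqnorm x] times a reflection. Reflections are
    anticonformal, hence orthogonal to the conformal matrix [1%:M - P], and have squared norm 2:
    Pythagoras gives the two terms. *)
Lemma frob_stretch_out P x : SO2 R P -> 1 <= sqnorm x ->
  frob (stretch x - P) ^+ 2 = 4 * (1 - P ord0 ord0) + 8 / sqnorm x ^+ 2.
Proof.
move=> /SO2_entries[P11 P01 P00] x1.
rewrite frob_sqr !mxE/= (prof_ge1 x1) dprof_ge1// P11 P01 /coord/=.
have s0 : sqnorm x != 0 by rewrite gt_eqF// (lt_le_trans ltr01).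
have i1 : sqnorm x * (sqnorm x)^-1 = 1 by rewrite divff.
rewrite -!exprVn; set i := (sqnorm x)^-1 in i1 *.
rewrite /sqnorm in i1 *.
set c := P ord0 ord0 in P00 *; set e := P ord_max ord0 in P00 *.
transitivity (2 * (1 + (c ^+ 2 + e ^+ 2) - 2 * c) + 8 * i ^+ 2); last first.
  by rewrite P00; ring.
set p := x.1 in i1 *; set q := x.2 in i1 *.
(* Arranged so that [p ^+ 2 + q ^+ 2] occurs only multiplied by [i], where [i1] replaces it by 1. *)
transitivity (2 * (1 - c - 2 * i) ^+ 2 +
  8 * i * ((p ^+ 2 + q ^+ 2) * i) * (1 - c - 2 * i) +
  16 * i ^+ 2 * ((p ^+ 2 + q ^+ 2) * i) ^+ 2 + 2 * e ^+ 2); first by ring.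
by rewrite i1; ring.
Qed.


Definition grad (x : R * R) : 'M[R]_2 := R0 *m stretch x.

Lemma SO2_1 : SO2 R 1%:M.
Proof. by split; rewrite ?trmx1 ?mul1mx// det1. Qed.

Lemma SO2_N1 : SO2 R (- 1%:M).
Proof.
split; first by rewrite mulmxN mulmx1 linearN/= trmx1 opprK.
by rewrite -scaleN1r detZ det1; ring.
Qed.

Lemma SO2M P Q : SO2 R P -> SO2 R Q -> SO2 R (P *m Q).
Proof.
move=> [PP dP] [QQ dQ]; split; last by rewrite det_mulmx dP dQ mulr1.
by rewrite trmx_mul mulmxA -[_ *m P]mulmxA PP mulmx1.
Qed.

Lemma SO2_tr P : SO2 R P -> SO2 R P^T.
Proof. by move=> [PP dP]; split; [rewrite trmxK (mulmx1C PP)|rewrite det_tr]. Qed.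

Lemma frob_grad_sub P x : frob (grad x - R0 *m P) = frob (stretch x - P).
Proof. by rewrite /grad -mulmxBr frob_SO2. Qed.

(** A closed form for the distance, from which measurability is immediate, unlike from the
    infimum. *)
Definition dist_grad (x : R * R) : R :=
  (1 <= sqnorm x)%R%:R * (Num.sqrt 8 * (Num.max 1 (sqnorm x))^-1).

Lemma sqrt8_sqr : Num.sqrt 8 ^+ 2 = 8 :> R.
Proof. by rewrite sqr_sqrtr. Qed.

Lemma frob_grad_R0 x : frob (grad x - R0) ^+ 2 = 8 * (Num.max 1 (sqnorm x))^-1 ^+ 2.
Proof.
rewrite -[X in grad x - X]mulmx1 frob_grad_sub; have [x1|x1] := ltP (sqnorm x) 1.
  by rewrite (frob_stretch_in SO2_1)// mxE/= invr1; ring.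
by rewrite (frob_stretch_out SO2_1)// mxE/= exprVn; ring.
Qed.

Lemma inf_min (S : set R) m : S m -> lbound S m -> inf S = m.
Proof.
move=> Sm lbm; apply/eqP; rewrite eq_le; apply/andP; split.
  by apply: ge_inf => //; exists m.
by apply: lb_le_inf => //; exists m.
Qed.

(** In the disc the gradient is [- R0], itself a rotation in the plane. Outside, [frob_stretch_out]
    is smallest when the entry [P ord0 ord0] is 1, which [Q = R0] achieves. *)
Lemma dist_SO2_grad x : dist_SO2 (grad x) = dist_grad x.
Proof.
rewrite /dist_SO2 /dist_grad; have [x1|x1] := leP 1 (sqnorm x); last first.
  rewrite mul0r; apply: inf_min; last by move=> _ [Q _ <-]; exact: frob_ge0.
  exists (R0 *m - 1%:M); first exact: (SO2M hR0 SO2_N1).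
  apply/eqP; rewrite -sqrf_eq0 frob_grad_sub (frob_stretch_in SO2_N1)// !mxE/=.
  by apply/eqP; ring.
have s0 : 0 < sqnorm x by exact: lt_le_trans x1.
have h0 : 0 <= Num.sqrt 8 * (sqnorm x)^-1.
  by rewrite mulr_ge0// invr_ge0 ltW.
rewrite mul1r; apply: inf_min.
  exists R0 => //; apply/eqP; rewrite -(eqrXn2 (n := 2))// ?frob_ge0//.
  by rewrite frob_grad_R0 max_r// exprMn sqrt8_sqr.
move=> _ [Q SQ <-].
have -> : Q = R0 *m (R0^T *m Q) by rewrite mulmxA (mulmx1C hR0.1) mul1mx.
have SP := SO2M (SO2_tr hR0) SQ.
rewrite frob_grad_sub -(@ler_pXn2r _ 2)// ?nnegrE ?frob_ge0//.
rewrite (frob_stretch_out SP)// exprMn sqrt8_sqr exprVn lerDr.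
have [_ _ +] := SO2_entries SP; set c := _ ord0 ord0; set e := _ ord_max ord0 => ce.
have := sqr_ge0 e; nra.
Qed.

(** The constant term of [frob_stretch_out] vanishes only when the relative rotation [R0^T *m Q] has
    diagonal entry 1, which forces it to be the identity. *)
Lemma frob_grad_lower Q : SO2 R Q -> Q <> R0 ->
  exists2 k : R, 0 < k & forall x, 1 <= sqnorm x -> k <= frob (grad x - Q) ^+ 2.
Proof.
move=> SQ QR0.
have QE : Q = R0 *m (R0^T *m Q) by rewrite mulmxA (mulmx1C hR0.1) mul1mx.
have SP := SO2M (SO2_tr hR0) SQ.
exists (4 * (1 - (R0^T *m Q) ord0 ord0)); last first.
  move=> x x1; rewrite [X in grad x - X]QE frob_grad_sub (frob_stretch_out SP)// lerDl.
  by rewrite divr_ge0// sqr_ge0.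
have [P11 P01 P00] := SO2_entries SP.
set P := R0^T *m Q in QE SP P11 P01 P00 *.
have c1 : P ord0 ord0 <= 1 by have := sqr_ge0 (P ord_max ord0); nra.
rewrite mulr_gt0// subr_gt0 lt_neqAle c1 andbT; apply/eqP => c1'.
apply: QR0; rewrite QE (_ : P = 1%:M) ?mulmx1//.
have e0 : P ord_max ord0 = 0.
  by apply/eqP; rewrite -sqrf_eq0; apply/eqP; move: P00; rewrite c1'; lra.
have ordP (i : 'I_2) : i = ord0 \/ i = ord_max.
  by case: i => -[|[|//]] i; [left|right]; exact/val_inj.
apply/matrixP => i j; rewrite [RHS]mxE.
have [->|->] := ordP i; have [->|->] := ordP j => //=.
- by rewrite P01 e0 oppr0.
- by rewrite P11 c1'.
Qed.

End field.

(** * The norms *)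

Section norms.
Context {R : realType}.
Local Notation R1 := (measurableTypeR R).
Local Notation R2 := (measurableTypeR R * measurableTypeR R)%type.
Local Notation mu := (@lebesgue_measure R).

Lemma L2normE (f : R * R -> R) :
  L2norm f = ((\int[leb2 R]_x (f x ^+ 2)%:E) `^ 2^-1)%E.
Proof.
rewrite /L2norm unlock; congr (_ `^ _)%E; apply: eq_integral => x _ /=.
by rewrite powR_mulrn// real_normK// num_real.
Qed.

Lemma integral_sqrV_ge1 :
  (\int[mu]_(t in `[1%R, +oo[) ((Num.max 1 t)^-1 ^+ 2)%:E = 1%:E)%E.
Proof.
transitivity (\int[mu]_(t in `[1%R, +oo[) (t ^- 2)%:E)%E.
  apply: eq_integral => t; rewrite inE/= in_itv/= andbT => t1.
  by rewrite max_r// exprVn.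
have tV (t : R) : 0 < t -> is_derive t (1:R) (fun u : R => - u^-1) (t ^- 2).
  move=> t0; have := is_deriveV (f := id) (lt0r_neq0 t0) (is_derive_id t (1:R)).
  by move=> /is_deriveN; rewrite /GRing.scale/= mulr1 opprK.
rewrite (@ge0_continuous_FTC2y _ _ (fun u => - u^-1) _ 0).
- by rewrite invr1 -EFinB sub0r opprK.
- by move=> t t1; rewrite invr_ge0 sqr_ge0.
- apply: continuous_in_subspaceT => t; rewrite inE/= in_itv/= andbT => t1.
  apply: cvgV; first by rewrite sqrf_eq0 gt_eqF// (lt_le_trans ltr01).
  exact: exprn_continuous.
- rewrite -oppr0; apply: cvgN; apply/gtr0_cvgV0; last exact: cvg_id.
  by near=> t.
- by move=> t t1; have [] := tV t (lt_trans ltr01 t1).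
- apply: cvg_at_right_filter; apply: cvgN; apply: cvgV => //; exact: cvg_id.
- move=> t; rewrite in_itv/= andbT => t1; rewrite derive1E.
  by have [_] := tV t (lt_trans ltr01 t1).
Unshelve. all: by end_near. Qed.

Lemma integral_ge1_sqrV :
  (\int[mu]_(t in `[0%R, +oo[) ((1 <= t)%R%:R * (Num.max 1 t)^-1 ^+ 2)%:E = 1%:E)%E.
Proof.
rewrite -integral_sqrV_ge1 [LHS]integral_mkcond [RHS]integral_mkcond.
apply: eq_integral => t _; rewrite !patchE !mem_setE/= !in_itv/= !andbT.
case: (leP 1 t) => t1; last by rewrite mul0r; case: ifP.
by rewrite (le_trans ler01 t1) mul1r.
Qed.

(** The disc contributes 1 and the exterior 1. Against the value 1 of [integral_ge1_sqrV], this
    doubling is the source of the factor [Num.sqrt 2]. *)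
Lemma integral_sqrV_max :
  (\int[mu]_(t in `[0%R, +oo[) ((Num.max 1 t)^-1 ^+ 2)%:E = 2%:E)%E.
Proof.
have mf : measurable_fun [set: R] (fun t : R => (Num.max 1 t)^-1 ^+ 2).
  by apply: measurable_funX; exact: measurable_invmax.
pose A : set R := `[0%R, 1%R[%classic; pose B : set R := `[1%R, +oo[%classic.
have -> : [set` `[0%R, +oo[] = A `|` B.
  apply/seteqP; split => t; rewrite /A /B /= !in_itv/= !andbT.
    by move=> ->; case: (ltP t 1) => ?; [left|right].
  by move=> [/andP[]//|/(le_trans ler01)].
rewrite integral_setU//=; last 4 first.
- exact: measurable_itv.
- exact: measurable_itv.
- by apply/measurable_EFinP; exact: measurable_funTS.
- apply/disj_set2P/seteqP; split => // t; rewrite /A /B /= !in_itv/= andbT.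
  by move=> [/andP[_ t1]]; rewrite leNgt t1.
transitivity (1%:E + 1%:E : \bar R)%E; last by rewrite -EFinD.
congr (_ + _)%E; last exact: integral_sqrV_ge1.
transitivity (\int[mu]_(t in A) (cst 1%:E) t)%E.
  apply: eq_integral => t; rewrite inE/A/= in_itv/= => /andP[_ t1].
  by rewrite max_l ?ltW// invr1 expr1n.
rewrite integral_cst; last exact: measurable_itv.
by rewrite mul1e /A /= lebesgue_measure_itv/= lte_fin ltr01 -EFinB subr0.
Qed.


Section conclusion.
Variables (R0 : 'M[R]_2) (hR0 : SO2 R R0).

Lemma measurable_invmax_sqnorm :
  measurable_fun [set: R2] (fun x => (Num.max 1 (sqnorm x))^-1).
Proof. by have := measurableT_comp (@measurable_invmax R) (@measurable_sqnorm R). Qed.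

Lemma measurable_dist_grad : measurable_fun [set: R2] (@dist_grad R).
Proof.
apply: measurable_funM.
  by have := measurableT_comp (@measurable_ge1 R) (@measurable_sqnorm R).
by apply: measurable_funM => //; exact: measurable_invmax_sqnorm.
Qed.

(** One [d] serves both norms, so the unknown disc area cancels in their ratio. *)
Lemma grad_norms : exists2 d : R, 0 < d &
  L2norm_mx (fun x => grad R0 x - R0) = ((16 * d)%:E `^ 2^-1)%E /\
  L2norm (fun x => dist_SO2 (grad R0 x)) = ((8 * d)%:E `^ 2^-1)%E.
Proof.
have [d d0 radial] := @radial_integral R; exists d => //.
have mf : measurable_fun [set: R] (fun t : R => (Num.max 1 t)^-1 ^+ 2).
  by apply: measurable_funX; exact: measurable_invmax.
split; rewrite ?/L2norm_mx L2normE; congr (_ `^ _)%E.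
  pose h (t : R) := (8%:E * ((Num.max 1 t)^-1 ^+ 2)%:E)%E.
  transitivity (\int[leb2 R]_x h (sqnorm x))%E.
    by apply: eq_integral => x _; rewrite frob_grad_R0.
  rewrite radial; last 2 first.
  - by apply/measurable_EFinP; exact: measurable_funM.
  - by move=> t; rewrite lee_fin mulr_ge0// sqr_ge0.
  rewrite ge0_integralZl//; last 2 first.
  - by apply/measurable_EFinP; exact: measurable_funTS.
  - by move=> t _; rewrite lee_fin sqr_ge0.
  by rewrite [X in (_ * (_ * X))%E]integral_sqrV_max -!EFinM; congr EFin; ring.
pose h (t : R) := (8%:E * ((1 <= t)%R%:R * (Num.max 1 t)^-1 ^+ 2)%:E)%E.
transitivity (\int[leb2 R]_x h (sqnorm x))%E.
  apply: eq_integral => x _; rewrite dist_SO2_grad// /dist_grad /h -EFinM.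
  congr EFin; rewrite !exprMn sqrt8_sqr mulrCA; congr (_ * (_ * _)).
  by case: (1 <= _); rewrite ?expr1n ?expr0n.
have mg : measurable_fun [set: R] (fun t : R => (1 <= t)%R%:R * (Num.max 1 t)^-1 ^+ 2).
  by apply: measurable_funM => //; exact: measurable_ge1.
have g0 (t : R) : 0 <= (1 <= t)%R%:R * (Num.max 1 t)^-1 ^+ 2.
  by rewrite mulr_ge0// sqr_ge0.
rewrite radial; last 2 first.
- by apply/measurable_EFinP; exact: measurable_funM.
- by move=> t; rewrite lee_fin mulr_ge0.
rewrite ge0_integralZl//; last 2 first.
- by apply/measurable_EFinP; exact: measurable_funTS.
- by move=> t _; rewrite lee_fin.
by rewrite [X in (_ * (_ * X))%E]integral_ge1_sqrV -!EFinM; congr EFin; ring.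
Qed.

(** Puts each entry in the form of [weak_partial_prof], with row [i] of [R0] as coefficients. *)
Lemma gradE i j x : grad R0 x i j = R0 i j * prof (sqnorm x) +
  (\sum_l R0 i l * coord l x) * (dprof (sqnorm x) * (2 * coord j x)).
Proof.
rewrite !mxE mulr_suml (eq_bigr (fun l => (R0 i l * (l == j)%:R) * prof (sqnorm x) +
  R0 i l * coord l x * (dprof (sqnorm x) * (2 * coord j x)))); last first.
  by move=> l _; rewrite mxE; ring.
rewrite big_split/= -mulr_suml; congr (_ * _ + _).
rewrite (bigD1 j)//= eqxx mulr1 big1 ?addr0// => l /negbTE ->.
by rewrite mulr0.
Qed.

Lemma grad_locally_bounded i j : locally_bounded (fun x => grad R0 x i j).
Proof.
under eq_fun do rewrite gradE.
exact: (sum_coord_prof_gradient_locally_bounded (R0 i)).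
Qed.

Lemma measurable_frob_grad_sub Q :
  measurable_fun [set: R2] (fun x => frob (grad R0 x - Q) ^+ 2).
Proof.
have mG i j : measurable_fun [set: R2] (fun x => (grad R0 x - Q) i j).
  under eq_fun do rewrite mxE.
  by apply: measurable_funD => //; have [] := grad_locally_bounded i j.
under eq_fun do rewrite frob_sqr.
by do 3 (apply: measurable_funD; last exact: measurable_funX); exact: measurable_funX.
Qed.

Lemma L2norm_grad_infty Q : SO2 R Q -> Q <> R0 ->
  L2norm_mx (fun x => grad R0 x - Q) = +oo%E.
Proof.
move=> SQ QR0; rewrite /L2norm_mx L2normE.
have [k k0 kQ] := frob_grad_lower hR0 SQ QR0.
have [d d0 radial] := @radial_integral R.
suff -> : (\int[leb2 R]_x (frob (grad R0 x - Q) ^+ 2)%:E = +oo)%E.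
  by rewrite poweRyr// invr_eq0.
apply/eqP; rewrite -leye_eq.
(* A radial minorant, equal to [k] on the exterior of the disc, which has infinite area. *)
pose h (t : R) := (k * (1 <= t)%R%:R)%:E.
have mh : measurable_fun [set: R] h.
  by apply/measurable_EFinP; apply: measurable_funM => //; exact: measurable_ge1.
have h0 t : (0 <= h t)%E by rewrite lee_fin mulr_ge0// ltW.
apply: (@le_trans _ _ (\int[leb2 R]_x h (sqnorm x))%E); last first.
  apply: ge0_le_integral => //.
  - by have := measurableT_comp mh (@measurable_sqnorm R).
  - by apply/measurable_EFinP; exact: measurable_frob_grad_sub.
  - move=> x _; rewrite lee_fin; case: (leP 1 (sqnorm x)) => x1.
      by rewrite mulr1; exact: kQ.
    by rewrite mulr0 sqr_ge0.
rewrite radial// (_ : (\int[mu]_(t in `[0%R, +oo[) h t)%E = +oo%E) ?gt0_muley ?lte_fin//.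
transitivity (\int[mu]_(t in `[1%R, +oo[) (cst k%:E) t)%E.
  rewrite [LHS]integral_mkcond [RHS]integral_mkcond.
  apply: eq_integral => t _; rewrite !patchE !mem_setE/= !in_itv/= !andbT /h.
  case: (leP 1 t) => t1; last by rewrite mulr0; case: ifP.
  by rewrite (le_trans ler01 t1) mulr1.
rewrite integral_cst; last exact: measurable_itv.
by rewrite /= lebesgue_measure_itv/= ltry gt0_muley ?lte_fin.
Qed.

End conclusion.
End norms.

Theorem theorem1p6 (R : realType) (R0 : 'M[R]_2) (hR0 : SO2 R R0) :
  exists (u : R * R -> 'cV[R]_2) (G : R * R -> 'M[R]_2),
    [/\ W12loc_grad u G,
        (fun x => dist_SO2 (G x)) \in Lfun (leb2 R) 2%:E,
        ~ {ae leb2 R, forall x, dist_SO2 (G x) = 0},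
        is_min [set L2norm_mx (fun x => G x - Q) | Q in SO2 R]
               (L2norm_mx (fun x => G x - R0))
      & L2norm_mx (fun x => G x - R0) =
        ((Num.sqrt 2)%:E * L2norm (fun x => dist_SO2 (G x)))%E].
Proof.
pose u x : 'cV[R]_2 := prof (sqnorm x) *: (R0 *m \col_i coord i x).
exists u, (grad R0).
have [d d0 [nR0 ndist]] := grad_norms hR0.
split.
- move=> i.
  have uE : (fun x => u x i ord0) =
      (fun x => (\sum_l R0 i l * coord l x) * prof (sqnorm x)).
    apply/funext => x; rewrite !mxE mulrC; congr (_ * _).
    by apply: eq_bigr => l _; rewrite mxE.
  have gE j : (fun x => grad R0 x i j) = (fun x => R0 i j * prof (sqnorm x) +
     (\sum_l R0 i l * coord l x) * (dprof (sqnorm x) * (2 * coord j x))).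
    by apply/funext => x; exact: gradE.
  rewrite uE; split.
    by apply: locally_bounded_L2loc; exact: sum_coord_prof_locally_bounded.
  move=> j; split; first by apply: locally_bounded_L2loc; exact: grad_locally_bounded.
  by rewrite gE; exact: weak_partial_prof.
- apply/andP; rewrite !inE /=; split.
    rewrite (_ : (fun x => _) = @dist_grad R); first exact: measurable_dist_grad.
    by apply/funext => x; exact: dist_SO2_grad.
  by rewrite /finite_norm [X in (X < _)%E]ndist poweR_lty// ltry.
(* A distance vanishing almost everywhere would have norm 0, against the positive value given by
   [ndist]. *)
- move=> dist0.
  suff : L2norm (fun x => dist_SO2 (grad R0 x)) = 0%E.
    rewrite ndist poweR_EFin => -[/eqP].
    by rewrite powR_eq0 mulf_eq0 (gt_eqF d0) pnatr_eq0.
  rewrite L2normE (_ : (\int[_]_x _)%E = 0%E) ?poweR0r ?invr_eq0//.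
  have mdist : measurable_fun setT (fun x => (dist_SO2 (grad R0 x) ^+ 2)%:E).
    under eq_fun do rewrite dist_SO2_grad//.
    by apply/measurable_EFinP; apply: measurable_funX; exact: measurable_dist_grad.
  rewrite (ae_eq_integral (cst 0%E)) ?integral0//.
  move: dist0 => [N [mN N0 sN]]; exists N; split => // x xN; apply: sN => /= dx.
  by apply: xN => _; rewrite dx expr0n.
- split; first by exists R0.
  (* Every rotation other than [R0] gives an infinite norm, so minimality is immediate. *)
  move=> _ [Q SQ <-]; have [->//|/eqP QR0] := eqVneq Q R0.
  by rewrite (L2norm_grad_infty hR0 SQ QR0) leey.
- rewrite nR0 ndist !poweR_EFin -EFinM; congr EFin.
  rewrite !powR12_sqrt ?mulr_ge0 ?ltW// -sqrtrM//.
  by congr (Num.sqrt _); ring.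
Qed.
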